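(* There exist infinitely many pairwise non-isomorphic connected graphs $G$, all of whose vertices have degree $3$ or $4$, such that $$u(G)\ <\ \sum_{x\in V(G)}\frac{d_G(x)-2}{d_G(x)+1}.$$
   Context: Graphs are finite, undirected, without loops and multiple edges. $V(G)$ is the vertex set of $G$ and $d_G(x)$ is the degree of the vertex $x$ in $G$. For a connected graph $G$, $u(G)$ is the maximum, over all spanning trees $F$ of $G$, of the number of leaves (vertices of degree $1$) of $F$. *)

(* Defs.v *)
From mathcomp Require Import all_boot all_order all_algebra.
Set Implicit Arguments.
Unset Strict Implicit.
Unset Printing Implicit Defensive.

Record sgraph := SGraph {
  vertex :> finType;
  adj : rel vertex;
  adj_sym : symmetric adj;
  adj_irr : irreflexive adj }.

Definition isomorphic (G H : sgraph) : Prop :=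
  exists2 f : G -> H, bijective f & forall x y, adj (f x) (f y) = adj x y.

(* The next notions are stated for a relation [e], used below both with the
   adjacency of a graph and with that of its spanning subgraphs. *)

Definition degree (T : finType) (e : rel T) (x : T) : nat := #|[set y | e x y]|.

Definition connected (T : finType) (e : rel T) : bool :=
  (0 < #|T|) && [forall x, forall y, connect e x y].

(* A cycle has at least three vertices: [:: x; y] is a [ucycle] of a symmetric
   relation as soon as x and y are adjacent.  The bound on the length makes the
   predicate boolean; it is harmless, see [acyclicP]. *)
Definition acyclic (T : finType) (e : rel T) : bool :=
  [forall n : 'I_#|T|.+1, forall c : n.-tuple T, ucycleb e c ==> (n <= 2)].

Lemma acyclicP (T : finType) (e : rel T) :
  reflect (forall c : seq T, ucycle e c -> size c <= 2) (acyclic e).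
Proof.
apply: (iffP forallP) => [ac c uc | ac n].
  have /andP[_ uniq_c] : ucycleb e c := uc.
  have lec : size c < #|T|.+1 by rewrite ltnS -(card_uniqP uniq_c) max_card.
  by have /forallP/(_ (in_tuple c))/implyP := ac (Ordinal lec); apply.
by apply/forallP => c; apply/implyP => /ac; rewrite size_tuple.
Qed.

Definition is_tree (T : finType) (e : rel T) : bool := connected e && acyclic e.

Definition leaves (T : finType) (e : rel T) : {set T} :=
  [set x | degree e x == 1].

Definition edges (G : sgraph) : {set {set G}} :=
  [set [set p.1; p.2] | p : G * G & adj p.1 p.2].

(* A spanning subgraph of G is given by its set of edges F \subset edges G. *)
Definition edge_rel (T : finType) (F : {set {set T}}) : rel T :=
  [rel x y | [set x; y] \in F].

Definition spanning_tree (G : sgraph) (F : {set {set G}}) : bool :=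
  (F \subset edges G) && is_tree (edge_rel F).

Definition u (G : sgraph) : nat :=
  \max_(F : {set {set G}} | spanning_tree F) #|leaves (edge_rel F)|.

(* Main.v *)
(** Consider a chain of cliques of sizes 2, 2, 1, 1, 2, 2, 1, 1, ..., 2, 2, with
    consecutive cliques completely joined.  All degrees are 3 or 4, and a period
    of six vertices contributes 4 * 2/5 + 2 * 1/4 = 21/10 to the sum.  On the
    other hand every clique but the two extreme ones separates the graph, hence
    contains a vertex which is not a leaf of the spanning tree; so at most
    6 - 4 = 2 vertices of a period are leaves.  A surplus of 1/10 per period
    beats the bounded contribution of the ends once there are enough periods. *)
Require Import Defs.
From mathcomp Require Import all_boot all_order all_algebra.
From mathcomp Require Import zify lra.
Set Implicit Arguments.
Unset Strict Implicit.
Unset Printing Implicit Defensive.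
Import Order.TTheory GRing.Theory Num.Theory.
Local Open Scope ring_scope.

Section LayeredRelation.
Local Open Scope nat_scope.
Variables (T : finType) (e : rel T) (d : T -> nat).
Hypotheses (e_sym : symmetric e) (e_conn : connected e).
Hypothesis d_step : forall x y, e x y -> d y <= (d x).+1.

Lemma leaf_eq (x y z : T) : x \in leaves e -> e x y -> e x z -> y = z.
Proof.
rewrite inE => /cards1P[w Nx] exy exz.
have : y \in [set w] by rewrite -Nx inE.
have : z \in [set w] by rewrite -Nx inE.
by move=> /set1P -> /set1P ->.
Qed.

Lemma layer_nonleaf (l : nat) (x0 x1 : T) :
  d x0 < l -> l < d x1 -> exists2 x, d x = l & x \notin leaves e.
Proof.
move=> lt0 lt1.
have [/existsP[x /andP[/eqP dx nx]]|/existsPn no] :=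
  boolP [exists x, (d x == l) && (x \notin leaves e)]; first by exists x.
have leafl x : d x = l -> x \in leaves e.
  by move=> dx; have := no x; rewrite dx eqxx /= negbK.
(* If layer l consists of leaves, the vertices below it, together with the
   leaves of layer l attached to them, form a union of components. *)
pose A := [pred x | (d x < l) || (d x == l) && [exists y, e x y && (d y < l)]].
have stepA x y : e x y -> x \in A -> y \in A.
  move=> exy; rewrite !inE => /orP[dx|/andP[/eqP dx /existsP[z /andP[exz dz]]]].
    have le_dy := d_step exy; have [//|//|dy] := ltngtP (d y) l; first lia.
    by apply/existsP; exists x; rewrite e_sym exy.
  by rewrite (leaf_eq (leafl x dx) exy exz) dz.
have clA : closed e A by apply: intro_closed => //; apply: sym_connect_sym.
have /andP[_ /forallP/(_ x0)/forallP/(_ x1) c01] := e_conn.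
have := closed_connect clA c01; rewrite !inE lt0 /=; lia.
Qed.

(** Each of the layers 1 to [D] lies strictly between those of [x0] and [x1], so it contains a
    non-leaf; non-leaves from different layers are distinct. *)
Lemma card_leaves_layered (D : nat) (x0 x1 : T) :
  d x0 = 0 -> d x1 = D.+1 -> #|leaves e| + D <= #|T|.
Proof.
move=> d0 d1; rewrite -(cardsC (leaves e)) leq_add2l.
rewrite -(size_iota 1 D) cardE -(size_map d).
apply: uniq_leq_size (iota_uniq _ _) _ => l; rewrite mem_iota => /andP[l0 lD].
have [||x <- nx] := @layer_nonleaf l x0 x1; try lia.
by apply: map_f; rewrite mem_enum inE.
Qed.

End LayeredRelation.

Lemma edge_rel_adj (G : sgraph) (F : {set {set G}}) (x y : G) :
  F \subset edges G -> edge_rel F x y -> adj x y.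
Proof.
move=> /subsetP sF /sF /imsetP[[a b]]; rewrite inE /= => ab Exy.
have : (a \in [set x; y]) && (b \in [set x; y]) by rewrite Exy set21 set22.
have : (x \in [set a; b]) && (y \in [set a; b]) by rewrite -Exy set21 set22.
rewrite !inE => /andP[/pred2P[]-> /pred2P[]->]; rewrite ?orbb => /andP[] //.
- by move=> _ /eqP ba; rewrite ba in ab *.
- by rewrite adj_sym.
- by move=> /eqP ba; rewrite ba in ab *.
Qed.

(** Passing to a spanning tree only removes edges, so [d] still rises by at most one along those
    that remain, and the leaf bound applies to every spanning tree. *)
Lemma u_layered (G : sgraph) (d : G -> nat) (D : nat) (x0 x1 : G) :
  (forall x y : G, adj x y -> (d y <= (d x).+1)%N) ->
  d x0 = 0%N -> d x1 = D.+1 -> (u G <= #|G| - D)%N.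
Proof.
move=> d_step d0 d1; apply/bigmax_leqP => F /andP[sF /andP[connF _]].
have F_sym : symmetric (edge_rel F) by move=> x y; rewrite /edge_rel /= setUC.
have F_step x y : edge_rel F x y -> (d y <= (d x).+1)%N.
  by move=> /(edge_rel_adj sF) /d_step.
have := card_leaves_layered F_sym connF F_step d0 d1; lia.
Qed.

Lemma card_ord_interval (n a b : nat) :
  (b <= n)%N -> #|[set y : 'I_n | a <= y < b]%N| = (b - a)%N.
Proof.
move=> le_bn; rewrite -sum1dep_card.
rewrite -(big_mkord (fun y => a <= y < b)%N (fun=> 1%N)).
rewrite -(big_nat_widen 0 b n (fun y => a <= y)%N) //.
by rewrite -(big_nat_widenl a 0 b xpredT) // sum_nat_const_nat muln1.
Qed.

Section CliqueChain.
Local Open Scope nat_scope.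

(** Vertices are numbered along the chain: six consecutive ones fill four layers, and the list
    places each residue in its layer. *)
Definition layer (m : nat) : nat :=
  4 * (m %/ 6) + nth 0 [:: 0; 0; 1; 1; 2; 3] (m %% 6).

(** Without the list lookup, layers become accessible to [lia]. *)
Lemma layerE (m : nat) :
  layer m = 4 * (m %/ 6) + (1 < m %% 6) + (3 < m %% 6) + (4 < m %% 6).
Proof.
rewrite /layer -!addnA; congr (_ + _).
have : m %% 6 < 6 by rewrite ltn_mod.
by move: (m %% 6); do 6 case=> //.
Qed.

Variable N : nat.

(** The order [6 * N + 4] is that of [N] periods 2, 2, 1, 1 followed by a closing 2, 2. *)
Definition chain_adj : rel 'I_(6 * N + 4) :=
  [rel x y : 'I_(6 * N + 4) |
    [&& x != y, layer x <= (layer y).+1 & layer y <= (layer x).+1]].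

Lemma chain_adj_sym : symmetric chain_adj.
Proof. by move=> x y; rewrite /chain_adj /= [in LHS]eq_sym [X in _ && X]andbC. Qed.

Lemma chain_adj_irr : irreflexive chain_adj.
Proof. by move=> x; rewrite /chain_adj /= eqxx. Qed.

Definition chain : sgraph := SGraph chain_adj_sym chain_adj_irr.

Lemma chain_connected : connected (@adj chain).
Proof.
have pos : 0 < 6 * N + 4 by lia.
rewrite /connected card_ord pos /=.
(* Consecutive numbers lie in equal or consecutive layers, so the numbering itself traces a path
   from vertex 0. *)
have c0 (m : nat) (ltm : m < 6 * N + 4) :
    connect chain_adj (Ordinal pos) (Ordinal ltm).
  elim: m ltm => [|m IH] ltm; first by rewrite (bool_irrelevance ltm pos).
  apply: connect_trans (IH (ltnW ltm)) (connect1 _).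
  rewrite /chain_adj /= -val_eqE /= !layerE; lia.
have sym := sym_connect_sym chain_adj_sym.
apply/forallP => -[x ltx]; apply/forallP => -[y lty].
by apply: connect_trans (c0 y lty); rewrite sym.
Qed.

(* The layer function being monotone, neighbourhoods are intervals. *)
Lemma chain_degree_interval (x : chain) (a b : nat) :
    b <= 6 * N + 4 ->
    (forall y, y < 6 * N + 4 ->
       (a <= y < b) = (layer x <= (layer y).+1) && (layer y <= (layer x).+1)) ->
  degree (@adj chain) x = (b - a).-1.
Proof.
move=> le_b nbr; rewrite /degree.
have -> : [set y | adj x y] = [set y : chain | a <= (y : 'I__) < b] :\ x.
  by apply/setP => y; rewrite !inE nbr // eq_sym.
have := cardsD1 x [set y : chain | a <= (y : 'I__) < b].
by rewrite card_ord_interval // inE nbr // leqnSn => ->.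
Qed.

(** An inner vertex of a 2-clique sees its partner, a pair on one side and a singleton on the other;
    the end cliques lack that singleton. A singleton sees a pair and a singleton. *)
Lemma chain_degree (x : chain) :
  degree (@adj chain) x = if (2 <= x < 6 * N + 2) && (x %% 6 < 4) then 4 else 3.
Proof.
have ltx : (x : nat) < 6 * N + 4 := ltn_ord x.
pose q := 6 * ((x : nat) %/ 6).
have [a [b [le_b nbr eq_ab]]] : exists a b, [/\ b <= 6 * N + 4,
    forall y, y < 6 * N + 4 ->
       (a <= y < b) = (layer x <= (layer y).+1) && (layer y <= (layer x).+1) &
    (b - a).-1 = if (2 <= x < 6 * N + 2) && (x %% 6 < 4) then 4 else 3].
  have [r1|r1] := leqP (x %% 6) 1.
    (* In the first clique [q] is 0, and truncated subtraction gives the correct left end 0. *)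
    exists (q - 1), (q + 4); split; rewrite ?/q;
      [lia| |by case: ifP; lia].
    by move=> y lty; rewrite !layerE; lia.
  have [r3|r3] := leqP (x %% 6) 3.
    (* The minimum cuts off the singleton that would follow the last clique. *)
    exists q, (minn (q + 5) (6 * N + 4)); split; rewrite ?/q;
      [lia| |by case: ifP; lia].
    by move=> y lty; rewrite !layerE; lia.
  have [r4|r4] := leqP (x %% 6) 4.
    exists (q + 2), (q + 6); split; rewrite ?/q;
      [lia| |by case: ifP; lia].
    by move=> y lty; rewrite !layerE; lia.
  exists (q + 4), (q + 8); split; rewrite ?/q;
      [lia| |by case: ifP; lia].
  by move=> y lty; rewrite !layerE; lia.
by rewrite (chain_degree_interval le_b nbr).
Qed.

Lemma u_chain : u chain <= 2 * N + 4.
Proof.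
have lt0 : 0 < 6 * N + 4 by lia.
have lt1 : 6 * N + 3 < 6 * N + 4 by lia.
(* The last vertex lies in layer [4 * N + 1], which leaves [4 * N] inner layers. *)
have u_le := @u_layered chain (fun x => layer (x : 'I__)) (4 * N)
  (Ordinal lt0) (Ordinal lt1).
apply: leq_trans (u_le _ _ _) _; last by rewrite card_ord; lia.
- by move=> x y /and3P[_ _ ->].
- by [].
- by rewrite /= layerE; lia.
Qed.

End CliqueChain.

Definition degree_weight (d : nat) : rat := (d%:R - 2) / (d%:R + 1).

Lemma degree_weight3 : degree_weight 3 = 1 / 4.
Proof. by rewrite /degree_weight; congr (_ / _); lra. Qed.

Lemma degree_weight4 : degree_weight 4 = 2 / 5.
Proof. by rewrite /degree_weight; congr (_ / _); lra. Qed.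

Lemma chain_weight (N : nat) :
  21 / 10 * N%:R <=
    \sum_(x : chain N) degree_weight (degree (@adj (chain N)) x).
Proof.
pose c m : rat := if (m %% 6 < 4)%N then 2 / 5 else 1 / 4.
(* Dropping the two vertices at each end, of positive weight, leaves exactly [N] periods, each
   starting at residue 2. *)
pose G m : rat := if (2 <= m < 6 * N + 2)%N then c m else 0.
apply: (@le_trans _ _ (\sum_(x < 6 * N + 4) G x)); last first.
  apply: ler_sum => x _; rewrite chain_degree /G /c.
  by case: (1 < _ < _)%N; case: (_ < 4)%N => /=;
     rewrite ?degree_weight3 ?degree_weight4; lra.
rewrite -(big_mkord xpredT G) (big_cat_nat (n := 2)) /=; [|by []|lia].
rewrite big_nat big1 ?add0r => [|m]; last by rewrite /G; case: ifP => //; lia.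
rewrite (big_cat_nat (n := (6 * N + 2)%N)) /=; [|lia|lia].
rewrite [X in _ + X]big_nat [X in _ + X]big1 ?addr0 => [|m]; last first.
  by rewrite /G; case: ifP => //; lia.
have -> : \sum_(2 <= m < 6 * N + 2) G m = \sum_(2 <= m < 6 * N + 2) c m.
  by apply: eq_big_nat => m; rewrite /G => ->.
have period M : \sum_(6 * M + 2 <= m < 6 * M.+1 + 2) c m = 21 / 10.
  rewrite -[X in \sum_(X <= _ < _) _]add0n big_addn.
  rewrite (_ : 6 * M.+1 + 2 - (6 * M + 2) = 6)%N; last lia.
  rewrite (eq_bigr (fun i => c (i + 2)%N)) => [|i _]; last first.
    by rewrite /c (_ : (i + (6 * M + 2)) %% 6 = (i + 2) %% 6)%N //; lia.
  rewrite /index_iota /= !big_cons big_nil /c /=; lra.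
elim: N {G} => [|M IH]; first by rewrite mulr0 big_geq ?lexx.
rewrite (big_cat_nat (n := (6 * M + 2)%N)) /=; [|lia|lia].
by rewrite period -(natr1 M) mulrDr mulr1 lerD2r.
Qed.

Theorem mainTheorem3 :
  exists G : nat -> sgraph,
    (forall i j : nat, i <> j -> ~ isomorphic (G i) (G j)) /\
    (forall i : nat,
      [/\ connected (@adj (G i)),
          forall x : G i, degree (@adj (G i)) x = 3%N \/ degree (@adj (G i)) x = 4%N &
          (u (G i))%:R <
            \sum_(x : G i) ((degree (@adj (G i)) x)%:R - 2) /
                           ((degree (@adj (G i)) x)%:R + 1) :> rat]).
Proof.
(* The inequality 2N + 4 < 21N/10 means N > 40, whence 41; the graphs are told apart by their
   orders. *)
exists (fun i => chain (41 + i)); split=> [i j neq_ij [f /bij_eq_card]|i].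
  by rewrite !card_ord; lia.
split; first exact: chain_connected.
  by move=> x; rewrite chain_degree; case: ifP; [right | left].
apply: lt_le_trans (chain_weight _).
apply: (@le_lt_trans _ _ (2 * (41 + i) + 4)%:R); first by rewrite ler_nat u_chain.
by rewrite natrD natrM natrD; have := ler0n rat i; lra.
Qed.
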